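(* Let $s\ge 2$ and let $w$ be a word over $\Sigma_s$ with $\mathrm{core}_{a_{1,s}}(w)\neq\lambda$, and assume $\mathcal{G}(w)$ is connected. Then the diameter of $\mathcal{G}(w)$ is at most $s+3$ when $s\ge 3$, and at most $3$ when $s=2$.
   Context: $\Sigma_s$ denotes the ordered alphabet $\{a_1<a_2<\dots<a_s\}$, $a_{1,s}$ denotes the word $a_1a_2\cdots a_s$, and $\lambda$ is the empty word. For words $v,w$, $\mathrm{core}_v(w)$ is the subword of $w$ consisting of exactly those letters (occurrences) of $w$ that belong to at least one occurrence of $v$ as a (scattered) subword of $w$; so $\mathrm{core}_{a_{1,s}}(w)\ne\lambda$ means $a_1a_2\cdots a_s$ occurs as a scattered subword of $w$. For a nonempty word $w=w_1\cdots w_n$ over $\Sigma_s$, the Parikh graph $\mathcal{G}(w)$ is the simple undirected graph on $\{1,\dots,n\}$ where, for $i<j$, $i$ and $j$ are adjacent iff $w_i=a_k$ and $w_j=a_{k+1}$ for some $1\le k\le s-1$. *)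

(* Defs.v *)
From mathcomp Require Import all_boot.

Set Implicit Arguments.
Unset Strict Implicit.
Unset Printing Implicit Defensive.

(* A word over Sigma_s = {a_1 < ... < a_s} is a [seq 'I_s]; the letter a_k is
   the ordinal of value k - 1, and positions 1, ..., n of a word are likewise
   numbered from 0. *)

Section Words.

Variable s : nat.
Implicit Types v w : seq 'I_s.

Definition a1s : seq 'I_s := enum 'I_s.

(* An occurrence of v as a scattered subword of w is a mask, i.e. a set of
   positions of w, that selects v. *)
Definition occurrence v w (m : (size w).-tuple bool) : bool := mask m w == v.

Definition core_mask v w : (size w).-tuple bool :=
  [tuple [exists m : (size w).-tuple bool, occurrence v m && tnth m i]
  | i < size w].

Definition core v w : seq 'I_s := mask (core_mask v w) w.

Definition letter_at w (i : 'I_(size w)) : 'I_s := tnth (in_tuple w) i.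

Definition parikh_arc w : rel 'I_(size w) :=
  fun i j => (i < j) && ((letter_at i).+1 == letter_at j).

Definition parikh_graph w : rel 'I_(size w) :=
  fun i j => parikh_arc i j || parikh_arc j i.

Lemma parikh_graph_sym w : symmetric (@parikh_graph w).
Proof. by move=> i j; rewrite /parikh_graph orbC. Qed.

Lemma parikh_graph_irr w : irreflexive (@parikh_graph w).
Proof. by move=> i; rewrite /parikh_graph /parikh_arc ltnn. Qed.

End Words.

Arguments parikh_graph {s} w.

Section Graphs.

Variables (T : finType) (e : rel T).

Definition graph_connected : Prop := forall x y : T, connect e x y.

Definition has_walk (x y : T) (d : nat) : bool :=
  [exists p : d.-tuple T, path e x p && (last x p == y)].

(* The least length of a walk from x to y.  It is less than #|T| when such a
   walk exists; otherwise the value is #|T|, by convention. *)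
Definition gdist (x y : T) : nat := find (has_walk x y) (iota 0 #|T|).

Definition diameter : nat := \max_(x : T) \max_(y : T) gdist x y.

Lemma has_walkP x y d :
  reflect (exists p, [/\ path e x p, last x p = y & size p = d])
          (has_walk x y d).
Proof.
apply: (iffP existsP) => [[p /andP[ep /eqP lp]]|[p [ep lp /eqP sp]]].
  by exists p; rewrite size_tuple.
by exists (Tuple sp); rewrite /= ep lp eqxx.
Qed.

Lemma gdist_walk x y : connect e x y -> has_walk x y (gdist x y).
Proof.
case/connectP=> p0 /shortenP[p ep up _] lp.
have ltp : size p < #|T| by rewrite -[(size p).+1]/(size (x :: p))
  -(card_uniqP up) max_card.
have hasw : has (has_walk x y) (iota 0 #|T|).
  apply/hasP; exists (size p); first by rewrite mem_iota.
  by apply/has_walkP; exists p.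
have := nth_find 0 hasw; rewrite nth_iota //.
by rewrite has_find size_iota in hasw.
Qed.

Lemma gdist_min x y d : has_walk x y d -> gdist x y <= d.
Proof.
move=> wd; rewrite leqNgt; apply/negP => ltd.
have ltT : d < #|T|.
  by apply: leq_trans ltd _; rewrite -[leqRHS](size_iota 0) find_size.
by have := before_find 0 ltd; rewrite nth_iota // add0n wd.
Qed.

End Graphs.

(* Main.v *)
Require Import Defs.
From mathcomp Require Import all_boot zify.

(** An occurrence of a_1...a_s in w is a path with s - 1 edges in the Parikh
   graph.  Every vertex is at distance at most 2 from this path: a vertex with
   an inner letter a_k is adjacent to the a_(k-1) or to the a_(k+1) of the path,
   and a vertex a_1 not adjacent to the a_2 of the path lies to its right, so
   that each of its neighbours, a letter a_2 further right, is adjacent to the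
   a_1 of the path (symmetrically for a_s).  This gives 2 + (s - 1) + 2.  For
   s = 2, given a vertex x = a_1 and a vertex y = a_2, either x precedes y, or
   a neighbour of y, which is left of y, and a neighbour of x, which is right
   of x, are adjacent. *)

Set Implicit Arguments.
Unset Strict Implicit.
Unset Printing Implicit Defensive.

Section Walks.

Variables (T : finType) (e : rel T).

(** The length is bounded rather than exact, so that estimates add up along a concatenation and can
    be weakened afterwards. *)
Definition walk_within (x y : T) (d : nat) : Prop :=
  exists p, [/\ path e x p, last x p = y & size p <= d].

Lemma walk_within_refl x : walk_within x x 0.
Proof. by exists [::]. Qed.

Lemma walk_within_edge x y : e x y -> walk_within x y 1.
Proof. by move=> exy; exists [:: y]; rewrite /= exy. Qed.

Lemma walk_within_trans x y z a b :
  walk_within x y a -> walk_within y z b -> walk_within x z (a + b).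
Proof.
move=> [p [ep lp sp]] [q [eq lq sq]]; exists (p ++ q).
by rewrite cat_path last_cat size_cat lp ep leq_add.
Qed.

Lemma walk_within_leq x y a b :
  a <= b -> walk_within x y a -> walk_within x y b.
Proof. by move=> ab [p [ep lp sp]]; exists p; split=> //; apply: leq_trans ab. Qed.

Lemma walk_within_sym x y d :
  symmetric e -> walk_within x y d -> walk_within y x d.
Proof.
move=> sym_e [p [ep <- sp]]; exists (rev (belast x p)).
rewrite rev_path (eq_path (e' := e)) => [|u v]; last exact: sym_e.
rewrite size_rev size_belast; split=> //.
by case: p {ep sp} => //= y' p; rewrite rev_cons last_rcons.
Qed.

Lemma diameter_leq d :
  (forall x y, walk_within x y d) -> diameter e <= d.
Proof.
move=> walks; apply/bigmax_leqP => x _; apply/bigmax_leqP => y _.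
have [p [ep lp sp]] := walks x y.
by apply: leq_trans sp; apply: gdist_min; apply/has_walkP; exists p.
Qed.

Lemma connected_neighbor x y :
  graph_connected e -> x != y -> exists z, e x z.
Proof.
move=> conn; case/connectP: (conn x y) => [[|z p] /= ep ->].
  by rewrite eqxx.
by exists z; case/andP: ep.
Qed.

End Walks.

Section ParikhGraph.

Variables (s : nat) (w : seq 'I_s).
Implicit Types i j : 'I_(size w).
Local Notation G := (parikh_graph w).
Local Notation c := (@letter_at s w).

Lemma parikh_graph_arc i j : i < j -> (c i).+1 = c j -> G i j.
Proof. by move=> ij cij; rewrite /parikh_graph /parikh_arc ij cij eqxx. Qed.

Lemma parikh_graphP i j :
  reflect (i < j /\ (c i).+1 = c j \/ j < i /\ (c j).+1 = c i) (G i j).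
Proof.
have arcP (u v : 'I_(size w)) : reflect (u < v /\ (c u).+1 = c v) (parikh_arc u v).
  by apply: (iffP andP) => -[uv /eqP].
by apply: (iffP orP) => -[] /arcP; [left | right | left | right].
Qed.

(** A nonempty core provides a mask selecting [a1s s]; [p] enumerates the selected positions from
    left to right. Taking [p] on [nat] keeps predecessors and successors of letters free of casts;
    only its values below [s] matter. *)
Lemma core_a1s_positions :
  core (a1s s) w <> [::] ->
  exists p : nat -> 'I_(size w),
    (forall k, k < s -> c (p k) = k :> nat) /\
    (forall k l, k < l -> l < s -> p k < p l).
Proof.
move=> core_neq0.
have [i0 /existsP[m /andP[/eqP occ _]]] :
    exists i, [exists m : (size w).-tuple bool,
                 occurrence (a1s s) m && tnth m i].
  (* If no position lies in an occurrence, [core_mask] is false everywhere and the core is empty. *)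
  apply/existsP; apply: contra_notT core_neq0 => /existsPn no_occ.
  apply: size0nil; rewrite size_mask ?size_tuple //.
  apply/eqP; rewrite -leqn0 leqNgt -has_count.
  apply/hasPn => b /tnthP[i ->]; rewrite tnth_mktuple; exact: no_occ.
(* The mask is applied to the positions instead of the letters, so [t] is increasing and its letters
   spell [a1s s]. *)
pose t := mask m (enum 'I_(size w)).
have ct : map c t = enum 'I_s.
  rewrite map_mask -[RHS]occ; congr mask.
  exact: map_tnth_enum (in_tuple w).
have size_t : size t = s by rewrite -(size_map c) ct size_enum_ord.
exists (nth i0 t); split=> [k ks | k l kl ls].
  by rewrite -(nth_map _ (c i0)) ?size_t // ct nth_enum_ord.
have sorted_t : sorted ltn (map val t).
  rewrite map_mask val_enum_ord; apply: sorted_mask (iota_ltn_sorted 0 _).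
  exact: ltn_trans.
rewrite -!(nth_map i0 0 val) ?size_t ?(ltn_trans kl) //.
apply: (sorted_ltn_nth ltn_trans) => //; rewrite inE size_map size_t //.
exact: ltn_trans ls.
Qed.

Variable p : nat -> 'I_(size w).
Hypothesis letter_p : forall k, k < s -> c (p k) = k :> nat.
Hypothesis p_incr : forall k l, k < l -> l < s -> p k < p l.
Hypothesis s_gt1 : 1 < s.
Hypothesis conn : graph_connected G.

(** The graph is connected and has two distinct vertices [p 0] and [p 1], one of which differs from
    [i]. *)
Lemma exists_neighbor i : exists j, G i j.
Proof.
have [i0|] := eqVneq i (p 0); last exact: connected_neighbor.
apply: (connected_neighbor (y := p 1) conn).
by rewrite i0 -val_eqE neq_ltn p_incr.
Qed.

Lemma walk_along_occurrence k l :
  k <= l -> l < s -> walk_within G (p k) (p l) (l - k).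
Proof.
move=> /subnK <-; rewrite addnK; elim: (l - k) => [_|d IH ls].
  exact: walk_within_refl.
rewrite -[X in walk_within _ _ _ X]addn1.
apply: walk_within_trans (IH (ltnW ls)) _.
apply/walk_within_edge/parikh_graph_arc; first exact: p_incr.
by rewrite !letter_p // ltnW.
Qed.

Lemma walk_to_occurrence i : exists2 k, k < s & walk_within G i (p k) 2.
Proof.
have ci := ltn_ord (c i).
have one k : G i (p k) -> walk_within G i (p k) 2.
  by move=> /walk_within_edge; apply: walk_within_leq.
have two j k : G i j -> G j (p k) -> walk_within G i (p k) 2.
  by move=> /walk_within_edge + /walk_within_edge; apply: walk_within_trans.
have next : (c i).+1 < s -> i < p (c i).+1 -> G i (p (c i).+1).
  by move=> ? ?; apply: parikh_graph_arc; rewrite ?letter_p.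
have prev : 0 < c i -> p (c i).-1 < i -> G i (p (c i).-1).
  move=> ci0 ?; rewrite parikh_graph_sym; apply: parikh_graph_arc => //.
  by rewrite letter_p ?prednK //; lia.
have [j Gij] := exists_neighbor i.
have [cs|cs] := ltnP (c i).+1 s.
  have [lt_i|le_i] := ltnP i (p (c i).+1).
    by exists (c i).+1; [|apply/one/next].
  have [ci0|ci0] := posnP (c i).
    (* Letter a_1: the neighbour [j] carries a_2 and [p 0 < p 1 <= i < j], so [j] is adjacent to
       [p 0]. *)
    exists 0; first exact: ltnW.
    apply: (two _ _ Gij); rewrite parikh_graph_sym.
    have p01 := p_incr (ltnSn 0) s_gt1; rewrite ci0 in le_i.
    have cp0 := letter_p (ltnW s_gt1).
    by apply: parikh_graph_arc; move/parikh_graphP: Gij; lia.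
  (* Inner letter: [p (c i).-1 < p (c i).+1 <= i], so [i] is adjacent to [p (c i).-1]. *)
  exists (c i).-1; first lia.
  apply/one/prev => //; apply: leq_trans le_i; apply: p_incr => //; lia.
have [lt_i|le_i] := ltnP (p (c i).-1) i.
  exists (c i).-1; first lia.
  by apply/one/prev => //; lia.
(* Letter a_s: the neighbour [j] carries a_(s-1) and [j < i <= p (c i).-1 < p (c i)], so [j] is
   adjacent to [p (c i)]. *)
exists (c i) => //; apply: (two _ _ Gij).
have pp : p (c i).-1 < p (c i) by apply: p_incr; lia.
have cp := letter_p ci; have cj := ltn_ord (c j).
by apply: parikh_graph_arc; move/parikh_graphP: Gij; lia.
Qed.

Lemma walk_within_add3 i j : walk_within G i j (s + 3).
Proof.
have [k ks wi] := walk_to_occurrence i; have [l ls wj] := walk_to_occurrence j.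
wlog kl : i j k l ks ls wi wj / k <= l.
  move=> W; case/orP: (leq_total k l) => ?; first exact: (W i j k l).
  by apply: walk_within_sym (parikh_graph_sym (w := w)) _; apply: (W j i l k).
have := walk_within_trans (walk_within_trans wi (walk_along_occurrence kl ls))
  (walk_within_sym (parikh_graph_sym (w := w)) wj).
(* The total is [2 + (l - k) + 2], where [l - k] is at most [s - 1]. *)
by apply: walk_within_leq; lia.
Qed.

Lemma walk_within3_binary i j : s = 2 -> walk_within G i j 3.
Proof.
move=> s2; wlog cij : i j / c i <= c j.
  move=> W; case/orP: (leq_total (c i) (c j)) => ?; first exact: W.
  by apply: walk_within_sym (parikh_graph_sym (w := w)) _; apply: W.
have ci := ltn_ord (c i); have cj := ltn_ord (c j).
have [i' Gi] := exists_neighbor i; have [j' Gj] := exists_neighbor j.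
have ci' := ltn_ord (c i'); have cj' := ltn_ord (c j').
have Wi := walk_within_edge Gi.
have Wj : walk_within G j' j 1.
  by apply: walk_within_edge; rewrite parikh_graph_sym.
have via k : G i k -> G k j -> walk_within G i j 3.
  move=> /walk_within_edge W /walk_within_edge W'.
  exact: walk_within_leq (walk_within_trans W W').
move: (Gi) (Gj) => /parikh_graphP Ai /parikh_graphP Aj.
have [ceq|cneq] := eqVneq (c i : nat) (c j).
  (* Equal letters: for a_1, a neighbour of the right one of [i] and [j] lies to the right of both
     and is adjacent to both; for a_2, the same holds with left in place of right. *)
  have [GG|nGG] := boolP (G i' j); first exact: via GG.
  apply: (via j'); last by rewrite parikh_graph_sym.
  apply/parikh_graphP; move/parikh_graphP: nGG; lia.
have [ij|ji] := ltnP i j.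
  apply: (@walk_within_leq _ _ _ _ 1) => //; apply: walk_within_edge.
  by apply: parikh_graph_arc; lia.
(* Here [j' < j <= i < i'], where [j'] carries a_1 and [i'] carries a_2. *)
have Gij' : G i' j' by apply/parikh_graphP; lia.
exact: walk_within_trans (walk_within_trans Wi (walk_within_edge Gij')) Wj.
Qed.

End ParikhGraph.

Theorem theorem5p2 (s : nat) (hs : 2 <= s) (w : seq 'I_s)
    (hcore : core (a1s s) w <> [::])
    (hconn : graph_connected (parikh_graph w)) :
  (3 <= s -> diameter (parikh_graph w) <= s + 3) /\
  (s = 2 -> diameter (parikh_graph w) <= 3).
Proof.
have [p [letter_p p_incr]] := core_a1s_positions hcore.
split=> [_|s2]; apply: diameter_leq => i j.
  exact: walk_within_add3 letter_p p_incr hs hconn i j.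
exact: walk_within3_binary p_incr hs hconn i j s2.
Qed.
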